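(* Equilibrium logic EQ has interpolation of the form $\varphi\mathrel{|\!\sim}\alpha\mathrel{|\!\sim}\psi$: for all formulas $\varphi,\psi$ with $\mu_2(\varphi)\subseteq M_2(\psi)$ there is a formula $\alpha$, containing only propositional variables common to $\varphi$ and $\psi$, such that $\mu_2(\varphi)\subseteq M_2(\alpha)$ and $\mu_2(\alpha)\subseteq M_2(\psi)$.
   Context: Fix a finite propositional language with variable set $L$, connectives $\neg,\wedge,\vee,\to$ and constants TRUE (value $2$), FALSE (value $0$). Models are functions $m:L\to\{0,1,2\}$, extended to formulas by the three-valued here-and-there (Gödel) semantics: $m(\varphi\wedge\psi)=\min\{m(\varphi),m(\psi)\}$; $m(\varphi\vee\psi)=\max\{m(\varphi),m(\psi)\}$; $m(\neg\varphi)=2$ if $m(\varphi)=0$ and $0$ otherwise; $m(\varphi\to\psi)=2$ if $m(\varphi)\le m(\psi)$ and $m(\psi)$ otherwise. $M_2(\varphi)=\{m: m(\varphi)=2\}$. A model $m$ is total iff $m(a)\neq1$ for all $a\in L$. $m\prec m'$ iff (for all $a\in L$: $m(a)=0\Leftrightarrow m'(a)=0$) and $\{a\in L:m(a)=2\}\subsetneq\{a\in L:m'(a)=2\}$. The set of equilibrium models of $\varphi$ is $\mu_2(\varphi)=\{m\in M_2(\varphi): m\text{ is total and there is no } m'\in M_2(\varphi)\text{ with } m'\prec m\}$. The consequence relation of EQ is $\varphi\mathrel{|\!\sim}\psi$ iff $\mu_2(\varphi)\subseteq M_2(\psi)$. *)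

(* Defs.v *)
From mathcomp Require Import all_boot all_order.

Set Implicit Arguments.
Unset Strict Implicit.
Unset Printing Implicit Defensive.

Inductive formula (L : Type) : Type :=
  | FVar of L
  | FTrue
  | FFalse
  | FNot of formula L
  | FAnd of formula L & formula L
  | FOr of formula L & formula L
  | FImp of formula L & formula L.

Arguments FTrue {L}.
Arguments FFalse {L}.

Fixpoint vars (L : finType) (f : formula L) : {set L} :=
  match f with
  | FVar a => [set a]
  | FTrue | FFalse => set0
  | FNot g => vars g
  | FAnd g h | FOr g h | FImp g h => vars g :|: vars h
  end.

(* The truth values 0, 1, 2 are the elements of 'I_3 with their usual order;
   ord0 is 0 and ord_max is 2. *)
Definition model (L : finType) := {ffun L -> 'I_3}.

Fixpoint eval (L : finType) (m : model L) (f : formula L) : 'I_3 :=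
  match f with
  | FVar a => m a
  | FTrue => ord_max
  | FFalse => ord0
  | FNot g => if eval m g == 0 :> nat then ord_max else ord0
  | FAnd g h => Order.min (eval m g) (eval m h)
  | FOr g h => Order.max (eval m g) (eval m h)
  | FImp g h => if eval m g <= eval m h then ord_max else eval m h
  end.

Definition M2 (L : finType) (f : formula L) : {set model L} :=
  [set m | eval m f == 2 :> nat].

Definition total (L : finType) (m : model L) : bool :=
  [forall a, m a != 1 :> nat].

Definition prec (L : finType) (m m' : model L) : bool :=
  [forall a, (m a == 0 :> nat) == (m' a == 0 :> nat)] &&
  ([set a | m a == 2 :> nat] \proper [set a | m' a == 2 :> nat]).

Definition mu2 (L : finType) (f : formula L) : {set model L} :=
  [set m in M2 f | total m && ~~ [exists m' in M2 f, prec m' m]].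

Definition eq_entails (L : finType) (f g : formula L) : bool :=
  mu2 f \subset M2 g.

(* Main.v *)
Require Import Defs.
From mathcomp Require Import all_boot all_order.

(** An equilibrium model of a formula vanishes outside the variables of the
    formula: otherwise lowering one such variable from 2 to 1 would give a
    smaller model ([mu2_notin_vars]).  Moreover every set of total valuations of
    a set [V] of variables is the set of here-and-there models, restricted to
    [V], of a formula over [V], namely the disjunction of its classical diagrams
    ([M2_diagrams]).

    Let [V] be the set of common variables and [alpha] the formula that describes
    in this way the restrictions to [V] of the equilibrium models of [phi].  These
    models satisfy [alpha].  Conversely an equilibrium model [m] of [alpha] agrees
    on [V] with some equilibrium model [t] of [phi].  On a variable of [psi] that
    is not in [V], hence not in [phi], both are 0.  So [m] and [t] agree on the
    variables of [psi], and [m] satisfies [psi] because [t] does. *)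

Lemma eq_eval (L : finType) (m m' : model L) (f : formula L) :
  {in vars f, m =1 m'} -> eval m f = eval m' f.
Proof.
elim: f => //= [a|f IHf|f IHf g IHg|f IHf g IHg|f IHf g IHg] eq_m.
- by rewrite eq_m ?set11.
- by rewrite IHf.
all: by rewrite IHf ?IHg // => a a_in; rewrite eq_m // inE a_in ?orbT.
Qed.

Lemma mu2_total (L : finType) (f : formula L) (m : model L) :
  m \in mu2 f -> Defs.total m.
Proof. by rewrite inE => /and3P[]. Qed.

Lemma mu2_M2 (L : finType) (f : formula L) (m : model L) :
  m \in mu2 f -> m \in M2 f.
Proof. by rewrite inE => /and3P[]. Qed.

(** Lowering [m a] from 2 to 1 does not change the value of [f], so it would
    contradict the minimality of [m]. *)
Lemma mu2_notin_vars (L : finType) (f : formula L) (m : model L) (a : L) :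
  m \in mu2 f -> a \notin vars f -> m a = ord0.
Proof.
move=> m_mu a_notin; apply/eqP; apply: contraT => ma_neq0.
have ma2 : m a = 2 :> nat.
  have /forallP/(_ a) := mu2_total _ _ _ m_mu.
  by case: (m a) ma_neq0 => [[|[|[|k]]] lt_k3].
pose m' : model L := [ffun x => if x == a then inord 1 else m x].
have m'a : m' a = 1 :> nat by rewrite ffunE eqxx inordK.
have m'E x : x != a -> m' x = m x by rewrite ffunE => /negPf->.
have m'_M2 : m' \in M2 f.
  rewrite inE (@eq_eval _ m' m) => [|x x_in].
    by have /mu2_M2 := m_mu; rewrite inE.
  by apply: m'E; apply: contraNneq a_notin => <-.
move: m_mu; rewrite inE => /and3P[_ _ /existsP[]].
exists m'; rewrite m'_M2 /=; apply/andP; split.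
  apply/forallP => x; have [->|/m'E-> //] := eqVneq x a.
  by rewrite m'a ma2.
apply/properP; split.
  apply/subsetP => x; rewrite !inE.
  by have [->|/m'E-> //] := eqVneq x a; rewrite ma2.
by exists a; rewrite inE ?ma2 ?m'a.
Qed.

Lemma M2_and (L : finType) (m : model L) (f g : formula L) :
  (m \in M2 (FAnd f g)) = (m \in M2 f) && (m \in M2 g).
Proof.
rewrite !inE /=.
by case: (eval m f) (eval m g) => [[|[|[|?]]] ?] [[|[|[|?]]] ?].
Qed.

Lemma M2_or (L : finType) (m : model L) (f g : formula L) :
  (m \in M2 (FOr f g)) = (m \in M2 f) || (m \in M2 g).
Proof.
rewrite !inE /=.
by case: (eval m f) (eval m g) => [[|[|[|?]]] ?] [[|[|[|?]]] ?].
Qed.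

Definition literal {L : finType} (t : model L) (a : L) : formula L :=
  if t a == 0 :> nat then FNot (FVar a) else FVar a.

Definition diagram {L : finType} (V : {set L}) (t : model L) : formula L :=
  \big[@FAnd L/FTrue]_(a in V) literal t a.

Definition diagrams {L : finType} (V : {set L}) (T : {set model L}) :
    formula L :=
  \big[@FOr L/FFalse]_(t in T) diagram V t.

Lemma vars_literal (L : finType) (t : model L) (a : L) :
  vars (literal t a) = [set a].
Proof. by rewrite /literal; case: ifP. Qed.

Lemma vars_diagrams (L : finType) (V : {set L}) (T : {set model L}) :
  vars (diagrams V T) \subset V.
Proof.
pose P (f : formula L) := vars f \subset V.
apply: (big_ind P) => [|f g Pf Pg|t _]; rewrite /P ?sub0set //=.
  by rewrite subUset; apply/andP.
apply: (big_ind P) => [|f g Pf Pg|a aV]; rewrite /P ?sub0set //=.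
  by rewrite subUset; apply/andP.
by rewrite vars_literal sub1set.
Qed.

(** A literal of a total [t] has value 2 only at the value of [t] itself: the
    intermediate value 1 is excluded by the atom and by its negation alike. *)
Lemma M2_literal (L : finType) (t m : model L) (a : L) :
  Defs.total t -> (m \in M2 (literal t a)) = (m a == t a).
Proof.
move=> /forallP/(_ a); rewrite inE /literal -val_eqE /=.
by case: (t a) => [[|[|[|?]]] ?] //=; case: (m a) => [[|[|[|?]]] ?].
Qed.

Lemma M2_diagram (L : finType) (V : {set L}) (t m : model L) :
  Defs.total t -> (m \in M2 (diagram V t)) = [forall a in V, m a == t a].
Proof.
move=> t_total.
rewrite (big_morph (fun f => m \in M2 f) (@M2_and L m) (_ : _ = true)) ?inE //.
by rewrite big_andE; apply: eq_forallb_in => a _; rewrite M2_literal.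
Qed.

Lemma M2_diagrams (L : finType) (V : {set L}) (T : {set model L})
    (m : model L) :
  {in T, forall t, Defs.total t} ->
  (m \in M2 (diagrams V T)) = [exists t in T, [forall a in V, m a == t a]].
Proof.
move=> T_total.
rewrite (big_morph (fun f => m \in M2 f) (@M2_or L m) (_ : _ = false)) ?inE //.
by rewrite big_orE; apply: eq_existsb_in => t tT; rewrite M2_diagram ?T_total.
Qed.

Theorem fact5p3p9 (L : finType) (phi psi : formula L) :
  eq_entails phi psi ->
  exists alpha : formula L,
    [/\ vars alpha \subset vars phi :&: vars psi,
        eq_entails phi alpha
      & eq_entails alpha psi].
Proof.
move=> /subsetP phi_psi.
pose V := vars phi :&: vars psi.
have alphaV := vars_diagrams _ V (mu2 phi).
have M2_alpha m := M2_diagrams _ V _ m (fun t => @mu2_total L phi t).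
exists (diagrams V (mu2 phi)); split=> //; apply/subsetP => m m_mu.
  by rewrite M2_alpha; apply/exists_inP; exists m => //; apply/forall_inP.
have := mu2_M2 _ _ _ m_mu.
rewrite M2_alpha => /exists_inP[t t_mu /forall_inP eq_mt].
have := phi_psi t t_mu; rewrite !inE (@eq_eval _ m t) // => a a_psi.
have [aV|a_notV] := boolP (a \in V); first exact/eqP/eq_mt.
rewrite (mu2_notin_vars _ _ _ _ m_mu); last first.
  by apply: contra a_notV; apply: (subsetP alphaV).
rewrite (mu2_notin_vars _ _ _ _ t_mu) //.
by apply: contra a_notV => a_phi; rewrite inE a_phi.
Qed.
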